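(* Let $G=(V,E)$ be a locally finite weighted graph satisfying the $CD\psi(n,-K)$ condition with $K\geq0$, where $\psi\in C^1(0,+\infty)$ is a concave function. Let $T>0$, let $f\in\ell^\infty(V)$ with $f>0$ everywhere and $R_f<\infty$, and for $t\in[0,T]$, $x\in V$ set $$v(t,x)=P_{T-t}f(x),\qquad \phi(t,x)=P_t\bigl(v(t,\cdot)\,\Gamma^\psi(v(t,\cdot))\bigr)(x).$$ Then for every positive $\alpha\in C^1[0,T]$ and every $\gamma\in C[0,T]$, on $[0,T]\times V$, $$\partial_t(\alpha\phi)\geq\left(\alpha'-\frac{4\alpha\gamma}{n}-2\alpha K\right)\phi+\frac{4\psi'(1)\alpha\gamma}{n}\Delta P_Tf-\frac{2\alpha\gamma^2}{n}P_Tf.$$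
   Context: A locally finite weighted graph $G=(V,E)$ here means a connected graph in which every vertex has finitely many neighbours, with a vertex measure $\mu:V\to(0,\infty)$ and symmetric edge weights $w_{xy}=w_{yx}>0$ for $x\sim y$ (adjacent), such that $D_\mu:=\sup_{x}\frac{\deg(x)}{\mu(x)}<\infty$ where $\deg(x)=\sum_{y\sim x}w_{xy}$, $\mu_{\max}:=\sup_x\mu(x)<\infty$, and $w_{\min}:=\inf_{x\sim y}w_{xy}>0$. For $f:V\to\mathbb R$, $\Delta f(x)=\frac1{\mu(x)}\sum_{y\sim x}w_{xy}(f(y)-f(x))$. $\Delta$ is bounded on $\ell^\infty(V)$ (bounded functions, sup norm), and $P_t=e^{t\Delta}=\sum_{k\ge0}\frac{t^k}{k!}\Delta^k$, $t\ge0$. For $f:V\to(0,\infty)$, $R_f:=\sup_{y\sim x}\frac{f(y)}{f(x)}$ (supremum over all ordered pairs of adjacent vertices). For $\psi\in C^1(0,\infty)$ and $f:V\to(0,\infty)$: $(\Delta^\psi f)(x)=\Delta\left[\psi\left(\frac{f}{f(x)}\right)\right](x)$. For concave $\psi$ put $\overline\psi(s)=\psi'(1)(s-1)-[\psi(s)-\psi(1)]$ and $\Gamma^\psi(f):=\Delta^{\overline\psi}f$, i.e. $\Gamma^\psi(f)(x)=\frac1{\mu(x)}\sum_{y\sim x}w_{xy}\overline\psi\left(\frac{f(y)}{f(x)}\right)$. Further $$\Omega^\psi f(x)=\Delta\left[\psi'\left(\frac f{f(x)}\right)\frac f{f(x)}\left(\frac{\Delta f}{f}-\frac{\Delta f(x)}{f(x)}\right)\right](x),$$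 $$2\Gamma_2^\psi(f)=\Omega^\psi(f)+\frac{\Delta f\cdot\Delta^\psi f}{f}-\frac{\Delta(f\cdot\Delta^\psi f)}{f}.$$ For $n>0$ and $\kappa\in\mathbb R$, $G$ satisfies $CD\psi(n,\kappa)$ if for every $f:V\to(0,\infty)$, pointwise on $V$, $\Gamma_2^\psi(f)\ge\frac1n(\Delta^\psi f)^2+\kappa\,\Gamma^\psi(f)$. Under the hypotheses on $f$, $v\,\Gamma^\psi(v)$ is bounded on $[0,T]\times V$, so $\phi$ is well defined. Derivatives in $t$ at the endpoints of $[0,T]$ are one-sided. *)

(* Defs.v *)
From HB Require Import structures.
From mathcomp Require Import all_boot all_order all_algebra.
From mathcomp Require Import all_classical all_reals all_analysis.

Set Implicit Arguments.
Unset Strict Implicit.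
Unset Printing Implicit Defensive.

Import Order.TTheory GRing.Theory Num.Theory.
Import numFieldNormedType.Exports.

Local Open Scope classical_set_scope.
Local Open Scope ring_scope.

(* The weight [wgt x y] is meaningful, and constrained, only when [x] and [y]
   are adjacent. Loops are neither required nor excluded. *)
Record wgraph (R : realType) (V : choiceType) := WGraph {
  adj : rel V;
  wgt : V -> V -> R;
  vmeas : V -> R;
  adj_sym : symmetric adj;
  adj_locally_finite : forall x, finite_set [set y | adj x y];
  adj_connected : forall x y, exists2 p : seq V, path adj x p & last x p = y;
  wgt_sym : forall x y, adj x y -> wgt x y = wgt y x;
  wgt_gt0 : forall x y, adj x y -> 0 < wgt x y;
  vmeas_gt0 : forall x, 0 < vmeas x
}.

Section graph_operators.
Context {R : realType} {V : choiceType} (G : wgraph R V).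
Implicit Types (f : V -> R) (psi : R -> R).

Definition deg (x : V) : R := \sum_(y \in [set y | adj G x y]) wgt G x y.

Definition D_mu : \bar R := ereal_sup [set (deg x / vmeas G x)%:E | x in setT].

Definition mu_max : \bar R := ereal_sup [set (vmeas G x)%:E | x in setT].

Definition w_min : \bar R :=
  ereal_inf [set (wgt G e.1 e.2)%:E | e in [set e | adj G e.1 e.2]].

Definition ratio_sup f : \bar R :=
  ereal_sup [set (f e.2 / f e.1)%:E | e in [set e | adj G e.1 e.2]].

Definition lap f (x : V) : R :=
  (vmeas G x)^-1 * \sum_(y \in [set y | adj G x y]) wgt G x y * (f y - f x).

(* For bounded [f] and finite [D_mu] the exponential series converges in the
   sup norm, so that its sum is the pointwise one used here. *)
Definition semigroup (t : R) f (x : V) : R :=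
  limn (series (fun k : nat => t ^+ k / k`!%:R * iter k lap f x)).

Definition lap_psi psi f (x : V) : R := lap (fun y => psi (f y / f x)) x.

Definition psi_bar psi (s : R) : R := derive1 psi 1 * (s - 1) - (psi s - psi 1).

Definition Gamma psi f : V -> R := lap_psi (psi_bar psi) f.

Definition Omega psi f (x : V) : R :=
  lap (fun y => derive1 psi (f y / f x) * (f y / f x)
                * (lap f y / f y - lap f x / f x)) x.

Definition Gamma2 psi f (x : V) : R :=
  2^-1 * (Omega psi f x + lap f x * lap_psi psi f x / f x
          - lap (fun y => f y * lap_psi psi f y) x / f x).

Definition CDpsi psi (n kappa : R) : Prop :=
  forall f, (forall x, 0 < f x) ->
  forall x, n^-1 * lap_psi psi f x ^+ 2 + kappa * Gamma psi f x
            <= Gamma2 psi f x.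

End graph_operators.

Definition C1_pos (R : realType) (psi : R -> R) : Prop :=
  {in `]0, +oo[, forall s, derivable psi s 1} /\
  {in `]0, +oo[, continuous (derive1 psi)}.

Definition concave_pos (R : realType) (psi : R -> R) : Prop :=
  convex_function (`]0, +oo[%classic : set R^o) (fun s => - psi s).

(* Derivative relative to [A]: one-sided at the endpoints of a segment. *)
Section derivative_within.
Context {R : realType}.
Implicit Types (A : set R) (h : R -> R) (t : R).

Definition derivable_within A h t : Prop :=
  cvg ((h s - h t) / (s - t) @[s --> within A t^']).

Definition derive_within A h t : R :=
  lim ((h s - h t) / (s - t) @[s --> within A t^']).

Definition C1_within A h : Prop :=
  (forall t, A t -> derivable_within A h t) /\
  {within A, continuous (derive_within A h)}.

End derivative_within.

(* Main.v *)
(* Along [v s = P_{T-s} f], the function [g s = v Gamma(v)] satisfies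
   [lap (g s) + d/ds (g s) = 2 v Gamma2(v)], whence [d/ds (P_s (g s))] equals
   [P_s (2 v Gamma2(v))]. The curvature condition bounds this from below, and
   [X^2 >= 2 c X - c^2] makes the bound affine in [lap_psi v], so that the
   semigroup law turns it into the right-hand side.

   The differentiation under [P_s] requires the difference quotients of [g] to
   converge uniformly on [V]. Since [lap f <= r D f] propagates along the
   semigroup, [v s y / v s x] stays, for adjacent [x] and [y], in a fixed
   segment [[C^-1, C]], on which [psi] and its derivative are uniformly
   continuous; the time derivative of [g] is then equicontinuous in time,
   uniformly on [V], even when [f] is not bounded away from 0. *)
Require Import Defs.
From mathcomp Require Import all_boot all_order all_algebra.
From mathcomp Require Import all_classical all_reals all_analysis.
From mathcomp Require Import ring lra.
Import Order.TTheory GRing.Theory Num.Theory.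
Import numFieldNormedType.Exports.
Local Open Scope classical_set_scope.
Local Open Scope ring_scope.

Set Implicit Arguments.
Unset Strict Implicit.
Unset Printing Implicit Defensive.

Lemma is_derive_mull {R : realType} (a : R) (f : R -> R) (t df : R) :
  is_derive t 1 f df -> is_derive t 1 (fun s => a * f s) (a * df).
Proof. by move=> ?; exact: (@is_deriveZ _ _ _ f a). Qed.

(** * Weighted sums over neighbours and the Laplacian *)

Section neighbour_average.
Context {R : realType} {V : choiceType} (G : wgraph R V).
Implicit Types (F H : V -> R) (x y : V).

(** Not normalized: the weights have total mass [deg G x / vmeas G x] instead of 1. Every operator
    below reduces to it, so linearity, monotonicity and bounds are proved once here. *)
Definition nbavg x F : R :=
  (vmeas G x)^-1 * \sum_(y \in [set y | adj G x y]) wgt G x y * F y.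

Definition nbrs x : seq V :=
  finmap.enum_fset (fset_set [set y | adj G x y]).

Lemma nbavgE x F : nbavg x F =
  (vmeas G x)^-1 * \sum_(y <- nbrs x) wgt G x y * F y.
Proof. by rewrite /nbavg fsbig_finite//; exact: adj_locally_finite. Qed.

Lemma in_nbrs x y : (y \in nbrs x) = adj G x y.
Proof.
have := @in_fset_set _ _ (adj_locally_finite G x) y.
by rewrite mem_setE.
Qed.

Lemma eq_nbavg x F H : (forall y, adj G x y -> F y = H y) ->
  nbavg x F = nbavg x H.
Proof.
move=> FH; rewrite !nbavgE; congr *%R.
by apply: eq_big_seq => y; rewrite in_nbrs => xy; rewrite FH.
Qed.

Lemma nbavgD x F H : nbavg x (fun y => F y + H y) = nbavg x F + nbavg x H.
Proof.
rewrite !nbavgE -mulrDr -big_split/=; congr *%R.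
by apply: eq_bigr => y _; rewrite mulrDr.
Qed.

Lemma nbavgZ x a F : nbavg x (fun y => a * F y) = a * nbavg x F.
Proof.
rewrite !nbavgE mulrCA; congr *%R; rewrite big_distrr/=.
by apply: eq_bigr => y _; rewrite mulrCA.
Qed.

Lemma nbavgN x F : nbavg x (fun y => - F y) = - nbavg x F.
Proof. by rewrite -mulN1r -nbavgZ; apply: eq_nbavg => y _; rewrite mulN1r. Qed.

Lemma nbavgB x F H : nbavg x (fun y => F y - H y) = nbavg x F - nbavg x H.
Proof. by rewrite nbavgD nbavgN. Qed.

Lemma nbavg_cst x a : nbavg x (fun=> a) = a * (deg G x / vmeas G x).
Proof.
rewrite nbavgE /deg fsbig_finite/=; last exact: adj_locally_finite.
by rewrite -big_distrl/= mulrC mulrAC mulrC.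
Qed.

Lemma ler_nbavg x F H : (forall y, adj G x y -> F y <= H y) ->
  nbavg x F <= nbavg x H.
Proof.
move=> FH; rewrite !nbavgE ler_wpM2l ?invr_ge0 ?(ltW (vmeas_gt0 _ _))//.
rewrite big_seq [leRHS]big_seq; apply: ler_sum => y; rewrite in_nbrs => xy.
by rewrite ler_wpM2l ?FH// (ltW (wgt_gt0 _)).
Qed.

Lemma ler_norm_nbavg x F : `|nbavg x F| <= nbavg x (fun y => `|F y|).
Proof.
rewrite ler_norml -nbavgN; apply/andP; split; apply: ler_nbavg => y _.
  by rewrite lerNl ler_normr lexx orbT.
exact: ler_norm.
Qed.

(** A single term is below the whole sum when all terms are nonnegative; this is how control of the
    Laplacian at [x] reaches an individual neighbour. *)
Lemma wgt_le_nbavg x y F : (forall z, adj G x z -> 0 <= F z) -> adj G x y ->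
  wgt G x y * F y <= vmeas G x * nbavg x F.
Proof.
move=> F0 xy; rewrite nbavgE mulrA mulfV ?mul1r ?gt_eqF ?vmeas_gt0//.
have yN : y \in nbrs x by rewrite in_nbrs.
rewrite (big_rem _ yN)/= lerDl big_seq; apply: sumr_ge0 => z.
move=> /mem_rem; rewrite in_nbrs => xz.
by rewrite mulr_ge0 ?F0// (ltW (wgt_gt0 _)).
Qed.

Lemma is_derive_nbavg x (F : V -> R -> R) (dF : V -> R) (t : R) :
  (forall y, adj G x y -> is_derive t 1 (F y) (dF y)) ->
  is_derive t 1 (fun s => nbavg x (F^~ s)) (nbavg x dF).
Proof.
move=> FdF; under eq_fun do rewrite nbavgE.
rewrite nbavgE; apply: is_derive_mull.
have : forall y, y \in nbrs x -> is_derive t 1 (F y) (dF y).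
  by move=> y; rewrite in_nbrs; exact: FdF.
elim: (nbrs x) => [_|y s IH FdFs].
  under eq_fun do rewrite big_nil.
  by rewrite big_nil; exact: is_derive_cst.
under eq_fun do rewrite big_cons.
rewrite big_cons; apply: is_deriveD.
  by apply: is_derive_mull; apply: FdFs; rewrite mem_head.
by apply: IH => z zs; apply: FdFs; rewrite in_cons zs orbT.
Qed.

Lemma cvg_nbavg (I : Type) (U : set_system I) {FU : Filter U} x
    (F : I -> V -> R) (l : V -> R) :
  (forall y, F i y @[i --> U] --> l y) ->
  nbavg x (F i) @[i --> U] --> nbavg x l.
Proof.
move=> Fl; under eq_fun do rewrite nbavgE.
rewrite nbavgE; apply: cvgMl_tmp.
elim: (nbrs x) => [|y s IH].
  under eq_fun do rewrite big_nil.
  by rewrite big_nil; exact: cvg_cst.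
under eq_fun do rewrite big_cons.
by rewrite big_cons; apply: cvgD => //; exact: cvgMl_tmp.
Qed.

Lemma lapE (f : V -> R) x : lap G f x = nbavg x (fun y => f y - f x).
Proof. by []. Qed.

Lemma lapE_deg (f : V -> R) x :
  lap G f x = nbavg x f - f x * (deg G x / vmeas G x).
Proof. by rewrite lapE nbavgB nbavg_cst. Qed.

Lemma lapD (f g : V -> R) x :
  lap G (fun y => f y + g y) x = lap G f x + lap G g x.
Proof. by rewrite !lapE -nbavgD; apply: eq_nbavg => y _; ring. Qed.

Lemma lapZ a (f : V -> R) x : lap G (fun y => a * f y) x = a * lap G f x.
Proof. by rewrite !lapE -nbavgZ; apply: eq_nbavg => y _; ring. Qed.

Lemma iter_lapD k (f g : V -> R) :
  iter k (lap G) (fun y => f y + g y) =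
  (fun y => iter k (lap G) f y + iter k (lap G) g y).
Proof.
by elim: k => //= k ->; apply/funext => x; rewrite lapD.
Qed.

Lemma iter_lapZ k a (f : V -> R) :
  iter k (lap G) (fun y => a * f y) = (fun y => a * iter k (lap G) f y).
Proof.
by elim: k => //= k ->; apply/funext => x; rewrite lapZ.
Qed.

Context {D : R} (degD : forall x, deg G x / vmeas G x <= D).

Lemma deg_ge0 x : 0 <= deg G x / vmeas G x.
Proof.
rewrite divr_ge0 ?(ltW (vmeas_gt0 _ _))// /deg fsbig_finite; last first.
  exact: adj_locally_finite.
rewrite big_seq; apply: sumr_ge0 => y; rewrite in_nbrs => xy.
exact/ltW/wgt_gt0.
Qed.

Lemma nbavg_bound x F M : 0 <= M -> (forall y, adj G x y -> `|F y| <= M) ->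
  `|nbavg x F| <= M * D.
Proof.
move=> M0 FM; apply: (le_trans (ler_norm_nbavg _ _)).
apply: (@le_trans _ _ (nbavg x (fun=> M))); first exact: ler_nbavg.
by rewrite nbavg_cst ler_wpM2l.
Qed.

Lemma lap_bound (f : V -> R) M x : (forall y, `|f y| <= M) ->
  `|lap G f x| <= 2 * D * M.
Proof.
move=> fM; have M0 : 0 <= M by apply: le_trans (fM x).
rewrite mulrAC mulrC -mulrC; apply: nbavg_bound; first by rewrite mulr_ge0.
by move=> y _; rewrite (le_trans (ler_normB _ _))// mulr_natl mulr2n lerD.
Qed.

Lemma iter_lap_bound k (f : V -> R) M x : (forall y, `|f y| <= M) ->
  `|iter k (lap G) f x| <= M * (2 * D) ^+ k.
Proof.
move=> fM; elim: k x => [|k IH] x; first by rewrite mulr1 fM.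
by rewrite iterS exprS mulrCA; exact: lap_bound.
Qed.

End neighbour_average.

(** * Exponential series with coefficients of geometric growth *)

Section exponential_series.
Context {R : realType}.
Implicit Types (a b : R^nat) (t q M : R).

(** For [a k = iter k lap f x] these are the terms of the series defining [semigroup]. *)
Definition egf_term a t : R^nat := fun k => t ^+ k / k`!%:R * a k.

Lemma egf_term_bound a M q t k :
  (forall k, `|a k| <= M * q ^+ k) ->
  `|egf_term a t k| <= M * exp_coeff (`|t| * q) k.
Proof.
move=> aM; rewrite /egf_term normrM exp_coeffE/= exprMn.
rewrite normrM normfV normrX [`|_%:R|]ger0_norm//.
rewrite [leRHS](_ : _ = `|t| ^+ k / k`!%:R * (M * q ^+ k)); last by ring.
by rewrite ler_wpM2l.
Qed.

Lemma cvg_egf a M q t : 0 <= M -> 0 <= q -> (forall k, `|a k| <= M * q ^+ k) ->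
  cvgn [normed series (egf_term a t)].
Proof.
move=> M0 q0 aM; apply: (@series_le_cvg _ _ (M *: exp_coeff (`|t| * q))) => /=.
- by move=> k; exact: normr_ge0.
- by move=> k; rewrite mulr_ge0// exp_coeff_ge0// mulr_ge0.
- by move=> k; exact: egf_term_bound.
- by apply: is_cvg_seriesZ; exact: is_cvg_series_exp_coeff.
Qed.

Lemma egf_bound a M q t : 0 <= M -> 0 <= q ->
  (forall k, `|a k| <= M * q ^+ k) ->
  `|limn (series (egf_term a t))| <= M * expR (`|t| * q).
Proof.
move=> M0 q0 aM; have c := @cvg_egf _ _ _ t M0 q0 aM.
apply: (le_trans (lim_series_norm c)).
have e := is_cvg_series_exp_coeff (`|t| * q).
have -> : M * expR (`|t| * q) = limn (series (M *: exp_coeff (`|t| * q))).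
  by rewrite lim_seriesZ.
apply: lim_series_le => //; first exact: is_cvg_seriesZ.
by move=> k; exact: egf_term_bound.
Qed.

(** Termwise differentiation of a power series. Shifting [a] only turns the constant [M] into
    [M * q], so the series and its first two derived series converge everywhere, in particular at
    [|t| + 1], beyond [t]. *)
Lemma is_derive_egf a M q t : 0 <= M -> 0 <= q ->
  (forall k, `|a k| <= M * q ^+ k) ->
  is_derive t 1 (fun s => limn (series (egf_term a s)))
    (limn (series (egf_term (fun k => a k.+1) t))).
Proof.
move=> M0 q0 aM.
pose c b : R^nat := fun k => b k / k`!%:R.
have cE b s : series (egf_term b s) = pseries (c b) s.
  rewrite /pseries; congr series; apply/funext => k /=.
  by rewrite /egf_term /c mulrC mulrA mulrAC.
(* The factor [k + 1] produced by differentiation is absorbed by the factorial, which leaves a plain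
   shift. *)
have dE b : pseries_diffs (c b) = c (fun k => b k.+1).
  apply/funext => k; rewrite /pseries_diffs /c factS natrM invfM.
  by rewrite mulrCA mulVKf.
have shiftM b N : 0 <= N -> (forall k, `|b k| <= N * q ^+ k) ->
    forall k, `|b k.+1| <= N * q * q ^+ k.
  by move=> N0 bN k; rewrite -mulrA -exprS.
have Mq0 : 0 <= M * q by rewrite mulr_ge0.
have cv b N K : 0 <= N -> (forall k, `|b k| <= N * q ^+ k) ->
    cvgn (pseries (c b) K).
  move=> N0 bN; rewrite -cE; apply: normed_cvg.
  exact: (@cvg_egf _ _ _ K N0 q0 bN).
under eq_fun do rewrite cE.
rewrite cE -dE; apply: (@pseries_snd_diffs _ _ (`|t| + 1)).
- exact: cv M0 aM.
- by rewrite dE; exact: cv Mq0 (shiftM _ _ M0 aM).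
- rewrite !dE; apply: (cv _ _ _ _ (shiftM _ _ Mq0 (shiftM _ _ M0 aM))).
  by rewrite mulr_ge0.
- by rewrite [ltRHS]ger0_norm ?addr_ge0// ltrDl ltr01.
Qed.

End exponential_series.

(** * Mean value theorem and elementary derivatives *)

Lemma mvt_closed {R : realType} (h dh : R -> R) (a b : R) : a <= b ->
  (forall s, s \in `[a, b] -> is_derive s 1 h (dh s)) ->
  exists2 c, c \in `[a, b] & h b - h a = dh c * (b - a).
Proof.
move=> ab hdh.
have hdh' s : s \in `]a, b[ -> is_derive s 1 h (dh s).
  by move=> /subset_itv_oo_cc; exact: hdh.
have hc : {within `[a, b], continuous h}.
  by apply: derivable_within_continuous => s /hdh[].
exact: MVT_segment ab hdh' hc.
Qed.

Lemma is_derive_ge0_le {R : realType} (h dh : R -> R) (a b : R) : a <= b ->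
  (forall s, s \in `[a, b] -> is_derive s 1 h (dh s)) ->
  (forall s, s \in `[a, b] -> 0 <= dh s) -> h a <= h b.
Proof.
move=> ab hdh dh0; have [c cab hE] := mvt_closed ab hdh.
by rewrite -subr_ge0 hE mulr_ge0 ?dh0// subr_ge0.
Qed.

Lemma is_derive_mul {R : realType} (f g : R -> R) (t df dg : R) :
  is_derive t 1 f df -> is_derive t 1 g dg ->
  is_derive t 1 (fun s => f s * g s) (df * g t + f t * dg).
Proof.
move=> fdf gdg; have := @is_deriveM _ _ f g t 1 df dg fdf gdg.
by rewrite /GRing.scale/= addrC [g t * _]mulrC.
Qed.

Lemma is_derive_comp_mull {R : realType} (f : R -> R) (a t df : R) :
  is_derive (a * t) 1 f df -> is_derive t 1 (fun s => f (a * s)) (df * a).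
Proof.
move=> fdf; apply: (@is_derive1_comp _ f (fun s => a * s)).
by rewrite -[X in is_derive _ _ _ X]mulr1; apply: is_derive_mull.
Qed.

Lemma is_derive_expRMl {R : realType} (a t : R) :
  is_derive t 1 (fun s => expR (a * s)) (a * expR (a * t)).
Proof. by rewrite mulrC; apply: is_derive_comp_mull. Qed.

Lemma is_derive_exp_coeff {R : realType} (k : nat) (t : R) :
  is_derive t 1 (fun s => exp_coeff s k.+1) (exp_coeff t k).
Proof.
rewrite (_ : exp_coeff t k = (k.+1`!%:R)^-1 * (k.+1%:R * t ^+ k)); last first.
  rewrite exp_coeffE/= factS natrM invfM mulrACA.
  by rewrite mulVf ?pnatr_eq0// mul1r.
under eq_fun do rewrite exp_coeffE/=.
apply: is_derive_mull.
have := @is_deriveX _ _ id k.+1 t 1 1 (is_derive_id _ _).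
by rewrite exprfctE /GRing.scale/= mulr1.
Qed.

(** * The heat semigroup on bounded functions *)

Section heat_semigroup.
Context {R : realType} {V : choiceType} (G : wgraph R V).
Context {D : R} (D0 : 0 <= D) (degD : forall x, deg G x / vmeas G x <= D).
Implicit Types (f g : V -> R) (x y : V) (t s M : R).

Local Notation lap := (lap G).
Local Notation S := (semigroup G).

Let q0 : 0 <= 2 * D. Proof. by rewrite mulr_ge0. Qed.

Let bound_ge0 f M x : (forall y, `|f y| <= M) -> 0 <= M.
Proof. by move=> /(_ x); exact: le_trans. Qed.

Lemma semigroup_bound f M t x : (forall y, `|f y| <= M) ->
  `|S t f x| <= M * expR (`|t| * (2 * D)).
Proof.
move=> fM; apply: (@egf_bound _ (fun k => iter k lap f x)) => //.
  exact: bound_ge0 x fM.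
by move=> k; exact: iter_lap_bound.
Qed.

Lemma cvg_semigroup f M t x : (forall y, `|f y| <= M) ->
  cvgn (series (egf_term (fun k => iter k lap f x) t)).
Proof.
move=> fM; apply: normed_cvg; apply: (@cvg_egf _ _ M (2 * D)) => //.
  exact: bound_ge0 x fM.
by move=> k; exact: iter_lap_bound.
Qed.

Lemma is_derive_semigroup f M t x : (forall y, `|f y| <= M) ->
  is_derive t 1 (fun s => S s f x) (S t (lap f) x).
Proof.
move=> fM; have -> : S t (lap f) x =
    limn (series (egf_term (fun k => iter k.+1 lap f x) t)).
  rewrite /semigroup; congr (limn (series _)); apply/funext => k.
  by rewrite /egf_term iterSr.
apply: (@is_derive_egf _ (fun k => iter k lap f x) M (2 * D)) => //.
  exact: bound_ge0 x fM.
by move=> k; exact: iter_lap_bound.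
Qed.

Lemma semigroupD f g M N t x :
  (forall y, `|f y| <= M) -> (forall y, `|g y| <= N) ->
  S t (fun y => f y + g y) x = S t f x + S t g x.
Proof.
move=> /cvg_semigroup fM /cvg_semigroup gN.
rewrite /semigroup -(lim_seriesD (fM t x) (gN t x)); congr (limn (series _)).
by apply/funext => k; rewrite iter_lapD mulrDr.
Qed.

Lemma semigroupZ a f M t x : (forall y, `|f y| <= M) ->
  S t (fun y => a * f y) x = a * S t f x.
Proof.
move=> /cvg_semigroup fM.
rewrite /semigroup -[RHS](lim_seriesZ _ (fM t x)); congr (limn (series _)).
by apply/funext => k; rewrite iter_lapZ mulrCA.
Qed.

Lemma semigroupB f g M N t x :
  (forall y, `|f y| <= M) -> (forall y, `|g y| <= N) ->
  S t (fun y => f y - g y) x = S t f x - S t g x.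
Proof.
move=> fM gN; rewrite -mulN1r -(semigroupZ _ _ _ gN).
rewrite -(semigroupD _ _ fM (N := N)).
  by congr (S t _ x); apply/funext => y; rewrite mulN1r.
by move=> y; rewrite mulN1r normrN.
Qed.

Lemma semigroup0 f x : S 0 f x = f x.
Proof.
(* From index 1 on, the partial sums reduce to their term of index 0, where [0 ^+ 0 = 1]. *)
apply/cvg_lim => //; apply: cvg_near_cst; exists 1%N => // -[//|n] _.
rewrite /series/= big_nat_recl//= big1 ?addr0; last first.
  by move=> k _; rewrite expr0n/= !mul0r.
by rewrite expr0 fact0 divr1 mul1r.
Qed.

(** The Laplacian at [x] involves finitely many values, so it passes to the pointwise limit of the
    partial sums, on which it acts term by term. *)
Lemma lap_semigroup f M t x : (forall y, `|f y| <= M) ->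
  lap (S t f) x = S t (lap f) x.
Proof.
move=> fM; apply/esym/cvg_lim => //.
pose P n y := series (egf_term (fun k => iter k lap f y) t) n.
have -> : series (fun k => t ^+ k / k`!%:R * iter k lap (lap f) x) =
    (fun n => lap (P n) x).
  apply/funext; elim => [|n IH].
    rewrite /series/= big_geq// lapE (eq_nbavg (H := fun=> 0)).
      by rewrite nbavg_cst mul0r.
    by move=> y _; rewrite /P /series/= !big_geq// subrr.
  rewrite seriesSr IH -iterSr/=.
  rewrite -[_ * _]lapZ -lapD; congr (lap _ x); apply/funext => y.
  by rewrite /P seriesSr.
rewrite lapE; under eq_fun do rewrite lapE.
apply: cvg_nbavg => y.
by apply: cvgB; exact: cvg_semigroup fM.
Qed.

(* Iterating the estimate [(e^{Dt} u)' >= - D sup (e^{Dt} u)^-] bounds the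
   negative part of [e^{Dt} u] by the terms of an exponential series. *)
Lemma heat_min_principle (u : R -> V -> R) (tau M : R) :
  (forall t x, t \in `[0, tau] -> is_derive t 1 (u^~ x) (lap (u t) x)) ->
  (forall t x, t \in `[0, tau] -> `|u t x| <= M) ->
  (forall x, 0 <= u 0 x) ->
  forall t x, t \in `[0, tau] -> 0 <= u t x.
Proof.
move=> du uM u0 t x t0tau.
have M0 : 0 <= M by apply: le_trans (uM t x t0tau).
(* [M'] dominates [|e^{Ds} u s y|] on [[0, tau]], which is the case [k = 0] of the induction. *)
pose M' := M * expR (D * tau).
have M'0 : 0 <= M' by rewrite mulr_ge0// expR_ge0.
have main k s y : s \in `[0, tau] ->
    - (M' * exp_coeff (D * s) k) <= expR (D * s) * u s y.
  elim: k s y => [|k IH] s y s0tau.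
    rewrite exp_coeffE/= fact0 invr1 mul1r expr0 mulr1.
    apply: (@le_trans _ _ (- `|expR (D * s) * u s y|)); last first.
      by rewrite lerNl ler_normr lexx orbT.
    rewrite lerN2 normrM [`|expR _|]ger0_norm ?expR_ge0// mulrC.
    by rewrite ler_pM ?expR_ge0 ?uM// ler_expR ler_wpM2l//; case/andP: s0tau.
  (* The derivative of the added term is [D] times the bound given by the induction hypothesis, so
     [h] is nondecreasing. *)
  pose h r := expR (D * r) * u r y + M' * exp_coeff (D * r) k.+1.
  pose dh r := D * expR (D * r) * u r y + expR (D * r) * lap (u r) y +
    M' * (exp_coeff (D * r) k * D).
  have /andP[s0 stau] : (0 <= s) && (s <= tau) by rewrite in_itv/= in s0tau.
  have sub (r : R) : r \in `[0, s] -> r \in `[0, tau].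
    rewrite !in_itv/= => /andP[-> rs]; exact: le_trans rs stau.
  suff : h 0 <= h s.
    have c0 : exp_coeff (0 : R) k.+1 = 0.
      by rewrite exp_coeffE/= expr0n/= mulr0.
    rewrite /h !mulr0 expR0 c0 mul1r mulr0 addr0 => h0.
    by rewrite -subr_ge0 opprK; exact: le_trans (u0 y) h0.
  have hdh (r : R) : r \in `[0, s] -> is_derive r 1 h (dh r).
    move=> /sub r0tau; apply: is_deriveD.
      exact: is_derive_mul (is_derive_expRMl D r) (du r y r0tau).
    apply: is_derive_mull.
    have e := is_derive_exp_coeff k (D * r).
    exact: is_derive_comp_mull e.
  apply: (is_derive_ge0_le s0 hdh) => r /sub r0tau.
  rewrite /dh lapE_deg.
  set d := deg G y / vmeas G y.
  have dD : 0 <= D - d by rewrite subr_ge0; exact: degD.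
  (* The exponential factor replaces the diagonal coefficient [- d] of the Laplacian by
     [D - d >= 0]. After regrouping, each summand is a nonnegative combination of quantities that
     the induction hypothesis makes nonnegative. *)
  have -> : D * expR (D * r) * u r y
    + expR (D * r) * (nbavg G y (u r) - u r y * d)
    + M' * (exp_coeff (D * r) k * D) =
    (nbavg G y (fun z => expR (D * r) * u r z) + M' * exp_coeff (D * r) k * d) +
    (D - d) * (expR (D * r) * u r y + M' * exp_coeff (D * r) k).
    by rewrite nbavgZ; ring.
  rewrite addr_ge0//.
    rewrite /d -nbavg_cst -nbavgD -(mul0r (deg G y / vmeas G y)) -nbavg_cst.
    by apply: ler_nbavg => z _; rewrite -lerBlDr sub0r IH.
  by rewrite mulr_ge0// -lerBlDr sub0r IH.
(* The terms of a convergent exponential series tend to 0, so the lower bounds vanish in the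
   limit. *)
have c : - (M' * exp_coeff (D * t) k) @[k --> \oo] --> - (M' * 0).
  by apply: cvgN; apply: cvgMl_tmp; exact: cvg_exp_coeff.
have : - (M' * 0) <= expR (D * t) * u t x.
  rewrite -(cvg_lim _ c)//; apply: limr_le; first exact: cvgP c.
  by near=> k; exact: main.
by rewrite mulr0 oppr0 pmulr_rge0// expR_gt0.
Unshelve. all: by end_near. Qed.

Lemma semigroup_ge0 f M t x : 0 <= t -> (forall y, `|f y| <= M) ->
  (forall y, 0 <= f y) -> 0 <= S t f x.
Proof.
move=> t0 fM f0.
apply: (@heat_min_principle (fun s => S s f) t (M * expR (t * (2 * D)))).
- move=> s y _; rewrite (lap_semigroup _ _ fM).
  exact: is_derive_semigroup fM.
- move=> s y; rewrite in_itv/= => /andP[s0 st].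
  rewrite (le_trans (semigroup_bound _ _ fM))// ler_wpM2l ?(bound_ge0 x fM)//.
  by rewrite ler_expR ler_wpM2r// ger0_norm.
- by move=> y; rewrite semigroup0.
- by rewrite in_itv/= t0 lexx.
Qed.

Lemma ler_semigroup f g M N t x : 0 <= t ->
  (forall y, `|f y| <= M) -> (forall y, `|g y| <= N) ->
  (forall y, f y <= g y) -> S t f x <= S t g x.
Proof.
move=> t0 fM gN fg; rewrite -subr_ge0 -(semigroupB _ _ gN fM).
apply: (@semigroup_ge0 _ (N + M)) => // y; last by rewrite subr_ge0.
by rewrite (le_trans (ler_normB _ _))// lerD.
Qed.

(** The map [s |-> e^{Ds} S s f x] starts from [f x > 0] and is nondecreasing: its derivative is a
    neighbour sum of nonnegative values plus a diagonal term with coefficient at least 0. *)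
Lemma semigroup_gt0 f M t x : 0 <= t -> (forall y, `|f y| <= M) ->
  (forall y, 0 < f y) -> 0 < S t f x.
Proof.
move=> t0 fM f0.
suff : f x <= expR (D * t) * S t f x.
  by move=> /(lt_le_trans (f0 x)); rewrite pmulr_rgt0// expR_gt0.
pose h s := expR (D * s) * S s f x.
pose dh s := D * expR (D * s) * S s f x + expR (D * s) * lap (S s f) x.
have <- : h 0 = f x by rewrite /h mulr0 expR0 mul1r semigroup0.
have hdh s : s \in `[0, t] -> is_derive s 1 h (dh s).
  move=> _; rewrite /dh (lap_semigroup _ _ fM).
  exact: is_derive_mul (is_derive_expRMl D s) (is_derive_semigroup s x fM).
apply: (is_derive_ge0_le t0 hdh) => s; rewrite in_itv/= => /andP[s0 st].
have Sf0 y : 0 <= S s f y by apply: semigroup_ge0 fM _ => // z; exact: ltW.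
rewrite /dh lapE_deg.
rewrite (_ : _ + _ = expR (D * s) *
  (nbavg G x (S s f) + (D - deg G x / vmeas G x) * S s f x)); last by ring.
rewrite mulr_ge0 ?expR_ge0// addr_ge0//.
  rewrite -(mul0r (deg G x / vmeas G x)) -nbavg_cst.
  by apply: ler_nbavg => y _.
by rewrite mulr_ge0// subr_ge0; exact: degD.
Qed.

(** Uniqueness for bounded solutions of the heat equation: both sides solve it in [t] with the same
    initial value, and the minimum principle applies to their difference and to its opposite. *)
Lemma semigroup_comp f M t s x : 0 <= t -> (forall y, `|f y| <= M) ->
  S t (S s f) x = S (t + s) f x.
Proof.
move=> t0 fM.
have SfM y : `|S s f y| <= M * expR (`|s| * (2 * D)).
  exact: semigroup_bound.
pose u r y := S r (S s f) y - S (r + s) f y.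
pose N := M * expR (`|s| * (2 * D)) * expR (t * (2 * D)) +
  M * expR ((t + `|s|) * (2 * D)).
have M0 := bound_ge0 x fM.
have du (r : R) y : is_derive r 1 (u^~ y) (lap (u r) y).
  have -> : lap (u r) y = S r (lap (S s f)) y - S (r + s) (lap f) y.
    rewrite -(lap_semigroup _ _ SfM) -(lap_semigroup _ _ fM).
    rewrite -mulN1r -lapZ -lapD; congr (lap _ y).
    by apply/funext => z; rewrite mulN1r.
  apply: is_deriveB; first exact: is_derive_semigroup SfM.
  rewrite -[X in is_derive _ _ _ X]mulr1.
  apply: (@is_derive1_comp _ (fun r => S r f y) (shift s)).
    exact: is_derive_semigroup fM.
  exact: is_derive_shift.
have uN (r : R) y : r \in `[0, t] -> `|u r y| <= N.
  rewrite in_itv/= => /andP[r0 rt].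
  rewrite (le_trans (ler_normB _ _))// lerD//.
    rewrite (le_trans (semigroup_bound _ _ SfM))//.
    rewrite ler_wpM2l ?mulr_ge0 ?expR_ge0//.
    by rewrite ler_expR ler_wpM2r// ger0_norm.
  rewrite (le_trans (semigroup_bound _ _ fM))// ler_wpM2l//.
  rewrite ler_expR ler_wpM2r// (le_trans (ler_normD _ _))// lerD2r.
  by rewrite ger0_norm.
have u0 y : u 0 y = 0 by rewrite /u semigroup0 add0r subrr.
have t0t : t \in `[0, t] by rewrite in_itv/= t0 lexx.
apply/eqP; rewrite -subr_eq0 eq_le; apply/andP; split; last first.
  by apply: (@heat_min_principle u t N) t0t => // y; rewrite u0.
rewrite -oppr_ge0.
apply: (@heat_min_principle (fun r y => - u r y) t N) t0t => [r y _|r y r0t|y].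
- rewrite (_ : lap _ _ = - lap (u r) y); first exact: is_deriveN.
  by rewrite -mulN1r -lapZ; congr (lap _ y); apply/funext => z; rewrite mulN1r.
- by rewrite normrN uN.
- by rewrite u0 oppr0.
Qed.

End heat_semigroup.

(** * Comparison of the heat flow at adjacent vertices *)

Section harnack.
Context {R : realType} {V : choiceType} (G : wgraph R V).
Context {D : R} (D0 : 0 <= D) (degD : forall x, deg G x / vmeas G x <= D).

Lemma lap_le_ratio (f : V -> R) (r : R) x : 0 <= r -> (forall y, 0 <= f y) ->
  (forall y, adj G x y -> f y <= r * f x) -> lap G f x <= r * D * f x.
Proof.
move=> r0 f0 fr; rewrite lapE_deg.
have d0 := deg_ge0 G x.
apply: (@le_trans _ _ (nbavg G x f)); first by rewrite gerBl mulr_ge0.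
apply: (@le_trans _ _ (nbavg G x (fun=> r * f x))); first exact: ler_nbavg.
by rewrite nbavg_cst mulrAC ler_wpM2r// ler_wpM2l.
Qed.

(* [lap] commutes with the semigroup, so that the bound [lap f <= r D f]
   propagates to [semigroup G s f]; each neighbour contributes a fixed
   proportion of the Laplacian. *)
Lemma semigroup_ratio (f : V -> R) (M r m w : R) s x y :
  0 <= s -> 0 <= r -> 0 < w -> 0 <= m -> (forall z, `|f z| <= M) ->
  (forall z, 0 <= f z) -> (forall z z', adj G z z' -> f z' <= r * f z) ->
  vmeas G x <= m -> adj G x y -> w <= wgt G x y ->
  semigroup G s f y <= m * ((r + 1) * D) / w * semigroup G s f x.
Proof.
move=> s0 r0 w0 m0 fM f0 fr mx xy wxy.
set u := semigroup G s f.
have u0 z : 0 <= u z by exact: (semigroup_ge0 D0 degD).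
have lapu : lap G u x <= r * D * u x.
  rewrite (lap_semigroup D0 degD _ _ fM) /u -(semigroupZ D0 degD _ _ _ fM).
  apply: (@ler_semigroup _ _ _ _ D0 degD _ _ (2 * D * M) (r * D * M)) => //.
  - by move=> z; exact: lap_bound.
  - by move=> z; rewrite normrM ger0_norm ?mulr_ge0// ler_wpM2l// mulr_ge0.
  - by move=> z; apply: lap_le_ratio => // z'; exact: fr.
(* Adding back the diagonal part of the Laplacian, at most [D * u x], turns [r] into [r + 1]. *)
have avgu : nbavg G x u <= (r + 1) * D * u x.
  move: lapu; rewrite lapE_deg lerBlDr => /le_trans; apply.
  by rewrite mulrDl mul1r mulrDl lerD2l mulrC ler_wpM2r.
rewrite mulrAC ler_pdivlMr//.
apply: (@le_trans _ _ (wgt G x y * u y)); first by rewrite mulrC ler_wpM2r.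
apply: (le_trans (wgt_le_nbavg (fun z _ => u0 z) xy)).
rewrite -mulrA ler_pM// ?(ltW (vmeas_gt0 _ _))//.
rewrite -(mul0r (deg G x / vmeas G x)) -nbavg_cst.
by apply: ler_nbavg => z _.
Qed.

End harnack.

(** * Compactness and mean values on a segment *)

Section segment_continuity.
Context {R : realType}.

Lemma segment_bounded (p : R -> R) (a b : R) :
  (forall r, r \in `[a, b] -> {for r, continuous p}) ->
  exists M, forall r, r \in `[a, b] -> `|p r| <= M.
Proof.
move=> pc; have /compact_near_coveringP cab := @segment_compact R a b.
have : \forall M \near +oo, `[a, b] `<=` (fun r => `|p r| <= M).
  apply: cab => r rab.
  have : \forall r' \near r, `|p r - p r'| < 1.
    by have /cvgrPdist_lt/(_ _ ltr01) := pc r rab.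
  move=> h; near=> r' M => /=.
  have -> : p r' = p r - (p r - p r') by ring.
  rewrite (le_trans (ler_normB _ _))//.
  apply: (@le_trans _ _ (`|p r| + 1)); last by near: M; exact: nbhs_pinfty_ge.
  by rewrite lerD2l ltW//; near: r'.
move=> /filter_ex[M hM]; exists M => r rab; exact: hM.
Unshelve. all: by end_near. Qed.

(** Only [r] has to lie in the segment: continuity is two-sided even at the endpoints, so the
    compactness argument lets [r'] fall slightly outside. *)
Lemma segment_unif_continuous (p : R -> R) (a b : R) :
  (forall r, r \in `[a, b] -> {for r, continuous p}) ->
  forall e, 0 < e -> exists2 d, 0 < d &
    forall r r', r \in `[a, b] -> `|r - r'| < d -> `|p r - p r'| <= e.
Proof.
move=> pc e e0; have /compact_near_coveringP cab := @segment_compact R a b.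
have : \forall d \near 0^'+, `[a, b] `<=`
    (fun r => forall r', `|r - r'| < d -> `|p r - p r'| <= e).
  apply: cab => r rab.
  have e20 : 0 < e / 2 by rewrite divr_gt0.
  have : \forall r' \near r, `|p r - p r'| < e / 2.
    by have /cvgrPdist_lt/(_ _ e20) := pc r rab.
  move=> /nbhs_ballP[d /= d0 hd].
  have d20 : 0 < d / 2 by rewrite divr_gt0.
  near=> r' d' => /= r'' r'r''.
  have rr' : `|r - r'| < d / 2 by near: r'; exact: nbhsx_ballx.
  have d'd : d' < d / 2 by near: d'; exact: nbhs_right_lt.
  have -> : p r' - p r'' = (p r - p r'') - (p r - p r') by ring.
  rewrite (le_trans (ler_normB _ _))// [leRHS]splitr lerD// ltW//; apply: hd.
    rewrite /ball/= (_ : r - r'' = (r - r') + (r' - r'')); last by ring.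
    rewrite (le_lt_trans (ler_normD _ _))// [ltRHS]splitr ltrD//.
    exact: lt_trans d'd.
  by rewrite /ball/= (lt_trans rr')// ltr_pdivrMr// ltr_pMr// ltr1n.
move=> h; have [d [hd /= d0]] := filter_ex (filterI h (nbhs_right_gt (0 : R))).
by exists d => // r r' rab; exact: hd.
Unshelve. all: by end_near. Qed.

(** The mean value theorem for [s] and [t] in either order; the distance bound records that [c] lies
    between them. *)
Lemma mvt_dist (h dh : R -> R) (a b s t : R) :
  s \in `[a, b] -> t \in `[a, b] ->
  (forall r, r \in `[a, b] -> is_derive r 1 h (dh r)) ->
  exists c, [/\ c \in `[a, b], `|c - t| <= `|s - t| &
    h s - h t = dh c * (s - t)].
Proof.
have itv_sub u u' c : u \in `[a, b] -> u' \in `[a, b] -> c \in `[u, u'] ->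
    c \in `[a, b].
  rewrite !in_itv/= => /andP[au _] /andP[_ u'b] /andP[uc cu'].
  by rewrite (le_trans au uc) (le_trans cu' u'b).
move=> sab tab hdh; have [st|/ltW ts] := leP s t.
  have [c cst E] :=
    mvt_closed st (fun r rst => hdh r (itv_sub _ _ _ sab tab rst)).
  exists c; split; first exact: itv_sub cst.
    move: cst; rewrite in_itv/= => /andP[sc ct].
    by rewrite !ler0_norm ?subr_le0// lerN2 lerD2r.
  by rewrite -opprB E -mulrN opprB.
have [c cst E] :=
  mvt_closed ts (fun r rst => hdh r (itv_sub _ _ _ tab sab rst)).
exists c; split=> //; first exact: itv_sub cst.
move: cst; rewrite in_itv/= => /andP[tc cs].
by rewrite !ger0_norm ?subr_ge0// lerD2r.
Qed.

End segment_continuity.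

(** * Families of functions of time, uniform in their index *)

Section equicontinuity.
Context {R : realType} {a b : R}.
Implicit Types (s t : R).

Definition bounded_family {I : Type} (J : set I) (F : R -> I -> R) : Prop :=
  exists2 M : R, 0 <= M & forall s i, s \in `[a, b] -> J i -> `|F s i| <= M.

(** The neighbourhood of [t] is chosen before the index [i]: this is continuity in time for the sup
    norm over [J], relative to the segment. *)
Definition equicontinuous_family {I : Type} (J : set I) (F : R -> I -> R) :=
 
  forall t e, t \in `[a, b] -> 0 < e ->
  \forall s \near t, s \in `[a, b] -> forall i, J i -> `|F s i - F t i| <= e.

(* Boundedness is kept along: equicontinuity alone is not stable by products. *)
Definition bequicont {I : Type} (J : set I) (F : R -> I -> R) : Prop :=
  bounded_family J F /\ equicontinuous_family J F.

Lemma bequicont_eq {I : Type} (J : set I) (F H : R -> I -> R) :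
  (forall s i, s \in `[a, b] -> J i -> F s i = H s i) ->
  bequicont J F -> bequicont J H.
Proof.
move=> FH [[M M0 FM] Fc]; split.
  by exists M => // s i sab Ji; rewrite -FH// FM.
move=> t e tab e0; apply: filterS (Fc t e tab e0) => s h sab i Ji.
by rewrite -!FH// h.
Qed.

Lemma bequicont_comp {I I' : Type} (J : set I) (J' : set I') (k : I' -> I)
    (F : R -> I -> R) : (forall i, J' i -> J (k i)) ->
  bequicont J F -> bequicont J' (fun s i => F s (k i)).
Proof.
move=> kJ [[M M0 FM] Fc]; split.
  by exists M => // s i sab /kJ; exact: FM.
move=> t e tab e0; have h := Fc t e tab e0.
by apply: filterS h => s h sab i /kJ; exact: h.
Qed.

Lemma bequicont_cst {I : Type} (J : set I) (c : R) : bequicont J (fun _ _ => c).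
Proof.
split; first by exists `|c|.
by move=> t e _ e0; near=> s => _ i _; rewrite subrr normr0 ltW.
Unshelve. all: by end_near. Qed.

Lemma bequicontD {I : Type} (J : set I) (F H : R -> I -> R) :
  bequicont J F -> bequicont J H -> bequicont J (fun s i => F s i + H s i).
Proof.
move=> [[M M0 FM] Fc] [[N N0 HN] Hc]; split.
  exists (M + N); first exact: addr_ge0.
  by move=> s i sab Ji; rewrite (le_trans (ler_normD _ _))// lerD ?FM ?HN.
move=> t e tab e0; have e20 : 0 < e / 2 by rewrite divr_gt0.
apply: filterS2 (Fc t _ tab e20) (Hc t _ tab e20) => s hF hH sab i Ji.
rewrite opprD addrACA (le_trans (ler_normD _ _))// [leRHS]splitr.
by rewrite lerD ?hF ?hH.
Qed.

Lemma bequicontM {I : Type} (J : set I) (F H : R -> I -> R) :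
  bequicont J F -> bequicont J H -> bequicont J (fun s i => F s i * H s i).
Proof.
move=> [[M M0 FM] Fc] [[N N0 HN] Hc]; split.
  exists (M * N); first exact: mulr_ge0.
  by move=> s i sab Ji; rewrite normrM ler_pM ?FM ?HN.
(* The product varies by at most [(M + N) * d]; the [+ 1] keeps the denominator positive. *)
move=> t e tab e0; pose d := e / (M + N + 1).
have MN0 : 0 < M + N + 1 by rewrite ltr_wpDl// addr_ge0.
have d0 : 0 < d by rewrite divr_gt0.
apply: filterS2 (Fc t _ tab d0) (Hc t _ tab d0) => s hF hH sab i Ji.
rewrite (_ : _ - _ = F s i * (H s i - H t i) + (F s i - F t i) * H t i);
  last by ring.
rewrite (le_trans (ler_normD _ _))// !normrM.
apply: (@le_trans _ _ (M * d + d * N)).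
  by rewrite lerD// ler_pM ?FM ?HN ?hF ?hH.
rewrite [d * N]mulrC -mulrDl /d mulrA ler_pdivrMr// mulrC ler_wpM2l ?(ltW e0)//.
by rewrite lerDl.
Qed.

Lemma bequicontZ {I : Type} (J : set I) (c : R) (F : R -> I -> R) :
  bequicont J F -> bequicont J (fun s i => c * F s i).
Proof. by move=> Fc; apply: bequicontM => //; exact: bequicont_cst. Qed.

Lemma bequicontN {I : Type} (J : set I) (F : R -> I -> R) :
  bequicont J F -> bequicont J (fun s i => - F s i).
Proof.
by move=> /(bequicontZ (-1)); apply: bequicont_eq => s i _ _; rewrite mulN1r.
Qed.

Lemma bequicontB {I : Type} (J : set I) (F H : R -> I -> R) :
  bequicont J F -> bequicont J H -> bequicont J (fun s i => F s i - H s i).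
Proof. by move=> Fc Hc; apply: bequicontD => //; exact: bequicontN. Qed.

Lemma bequicont_lipschitz {I : Type} (J : set I) (F dF : R -> I -> R) :
  (forall s i, s \in `[a, b] -> J i -> is_derive s 1 (F^~ i) (dF s i)) ->
  bounded_family J F -> bounded_family J dF -> bequicont J F.
Proof.
move=> FdF Fb [L L0 dFL]; split=> // t e tab e0.
have L10 : 0 < L + 1 by rewrite ltr_wpDl.
have d0 : 0 < e / (L + 1) by rewrite divr_gt0.
near=> s => sab i Ji.
have [c [cab _ ->]] := mvt_dist sab tab (fun r rab => FdF r i rab Ji).
rewrite normrM.
apply: (@le_trans _ _ ((L + 1) * `|s - t|)).
  by rewrite ler_wpM2r// (le_trans (dFL _ _ cab Ji))// lerDl.
rewrite -ler_pdivlMl// mulrC distrC; apply: ltW.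
by near: s; exact: nbhsx_ballx.
Unshelve. all: by end_near. Qed.

(** As all values stay in one segment, a single modulus of continuity of [p] serves every index. *)
Lemma bequicont_postcomp {I : Type} (J : set I) (p : R -> R) (c d : R)
    (F : R -> I -> R) :
  (forall r, r \in `[c, d] -> {for r, continuous p}) ->
  (forall s i, s \in `[a, b] -> J i -> F s i \in `[c, d]) ->
  bequicont J F -> bequicont J (fun s i => p (F s i)).
Proof.
move=> pc Fcd [_ Fc]; split.
  have [M pM] := segment_bounded pc.
  exists (Num.max 0 M); first by rewrite le_max lexx.
  by move=> s i sab Ji; rewrite le_max pM ?orbT// Fcd.
move=> t e tab e0; have [r r0 pr] := segment_unif_continuous pc e0.
have r20 : 0 < r / 2 by rewrite divr_gt0.
apply: filterS (Fc t _ tab r20) => s hF sab i Ji.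
apply: pr; rewrite ?Fcd// (le_lt_trans (hF sab i Ji))//.
by rewrite ltr_pdivrMr// ltr_pMr// ltr1n.
Qed.

(** Each quotient is [dF c i] for some [c] between [s] and [t]. This [c] depends on [i], which is
    harmless because [dF] is equicontinuous at [t]. *)
Lemma bequicont_quotient {I : Type} (J : set I) (F dF : R -> I -> R) t e :
  (forall s i, s \in `[a, b] -> J i -> is_derive s 1 (F^~ i) (dF s i)) ->
  bequicont J dF -> t \in `[a, b] -> 0 < e ->
  \forall s \near within `[a, b] t^', forall i, J i ->
    `|(F s i - F t i) / (s - t) - dF t i| <= e.
Proof.
move=> FdF [_ dFc] tab e0; have /nbhs_ballP[d /= d0 hd] := dFc t e tab e0.
suff : \forall s \near t, s != t -> s \in `[a, b] -> forall i, J i ->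
  `|(F s i - F t i) / (s - t) - dF t i| <= e by [].
near=> s => st sab i Ji.
have [c [cab cst ->]] := mvt_dist sab tab (fun r rab => FdF r i rab Ji).
rewrite mulfK ?subr_eq0//; apply: hd => //.
rewrite /ball/= distrC; apply: le_lt_trans cst _; rewrite distrC.
by near: s; exact: nbhsx_ballx.
Unshelve. all: by end_near. Qed.

(** Passage from oriented edges to vertices: the weights around a vertex have total mass at most
    [D], so uniform estimates lose only this factor. *)
Lemma bequicont_nbavg {V : choiceType} (G : wgraph R V) (D : R)
    (F : R -> V * V -> R) :
  0 <= D -> (forall x, deg G x / vmeas G x <= D) ->
  bequicont [set e | adj G e.1 e.2] F ->
  bequicont setT (fun s x => nbavg G x (fun y => F s (x, y))).
Proof.
move=> D0 degD [[M M0 FM] Fc]; split.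
  exists (M * D); first exact: mulr_ge0.
  by move=> s x sab _; apply: nbavg_bound => // y xy; exact: FM.
move=> t e tab e0; have D10 : 0 < D + 1 by rewrite ltr_wpDl.
have d0 : 0 < e / (D + 1) by rewrite divr_gt0.
apply: filterS (Fc t _ tab d0) => s hF sab x _.
rewrite -nbavgB; apply: (@le_trans _ _ (e / (D + 1) * D)).
  by apply: nbavg_bound => [||y xy]; [exact: degD|exact: ltW|exact: hF].
by rewrite mulrAC ler_pdivrMr// ler_wpM2l ?(ltW e0)// lerDl.
Qed.

Lemma bequicont_lap {V : choiceType} (G : wgraph R V) (D : R)
    (F : R -> V -> R) :
  0 <= D -> (forall x, deg G x / vmeas G x <= D) ->
  bequicont setT F -> bequicont setT (fun s => lap G (F s)).
Proof.
move=> D0 degD Fc.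
apply: (@bequicont_nbavg _ G D (fun s e => F s e.2 - F s e.1)) => //.
by apply: bequicontB; [exact: (bequicont_comp (J := setT) (k := snd))|
                       exact: (bequicont_comp (J := setT) (k := fst))].
Qed.

End equicontinuity.
Arguments bounded_family {R} a b {I}.
Arguments bequicont {R} a b {I}.

Lemma is_derive_quotient {R : realType} (f : R -> R) (t df : R) (A : set R) :
  is_derive t 1 f df -> (f s - f t) / (s - t) @[s --> within A t^'] --> df.
Proof.
move=> /is_derive1_caratheodory[g [fE gc <-]].
apply: cvg_within_filter.
have : g s @[s --> t^'] --> g t by apply/continuous_withinNx.
apply: cvg_trans; apply: near_eq_cvg; near=> s.
rewrite fE mulfK// subr_eq0; near: s; exact: nbhs_dnbhs_neq.
Unshelve. all: by end_near. Qed.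

Lemma near_eq_cvg_to {R : realType} {T : Type} {U : set_system T}
    {FU : Filter U} (f g : T -> R) (l : R) :
  (\forall s \near U, g s = f s) ->
  f s @[s --> U] --> l -> g s @[s --> U] --> l.
Proof.
by move=> fg; apply: cvg_trans; apply: near_eq_cvg; apply: filterS fg.
Qed.

(** * Differentiation of the semigroup applied to a moving function *)

Section derivative_of_moving_semigroup.
Context {R : realType} {V : choiceType} (G : wgraph R V).
Context {D : R} (D0 : 0 <= D) (degD : forall x, deg G x / vmeas G x <= D).

Lemma cvg_semigroup_quotient (T : R) (g dg : R -> V -> R) (t : R) (x : V) :
  bounded_family 0 T setT g -> bequicont 0 T setT dg ->
  (forall s y, s \in `[0, T] -> is_derive s 1 (g^~ y) (dg s y)) ->
  t \in `[0, T] ->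
  (semigroup G s (g s) x - semigroup G t (g t) x) / (s - t)
    @[s --> within `[0, T] t^'] -->
  semigroup G t (fun y => lap G (g t) y + dg t y) x.
Proof.
move=> [M M0 gM] dgc gdg t0T.
have [N N0 dgN] := dgc.1.
have gtM y : `|g t y| <= M by exact: gM.
have dgtN y : `|dg t y| <= N by exact: dgN.
rewrite (semigroupD D0 degD _ _ (fun y => lap_bound degD y gtM) dgtN) addrC.
have tT : 0 <= t <= T by rewrite in_itv/= in t0T.
pose Q s y := (g s y - g t y) / (s - t).
pose E := expR (T * (2 * D)).
have E0 : 0 < E by exact: expR_gt0.
pose A := within `[0, T]%classic t^'.
have FF : Filter A by exact: within_filter.
have inA : \forall s \near A, s \in `[0, T] by exact: withinT.
have neqt : \forall s \near A, s != t.
  by apply: cvg_within; have := nbhs_dnbhs_neq t.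
have At (h : R -> R) : {for t, continuous h} -> h s @[s --> A] --> h t.
  by move=> /continuous_withinNx; exact: cvg_within_filter.
have QdgE e : 0 < e -> \forall s \near A, forall y, `|Q s y - dg t y| <= e.
  move=> e0.
  have := bequicont_quotient (fun s y s0T _ => gdg s y s0T) dgc t0T e0.
  by apply: filterS => s h y; exact: h.
have QN : \forall s \near A, forall y, `|Q s y| <= N + 1.
  apply: filterS (QdgE _ ltr01) => s h y.
  rewrite (_ : Q s y = dg t y + (Q s y - dg t y)); last by ring.
  by rewrite (le_trans (ler_normD _ _))// lerD.
(* Uniformity in [y] enters here: [Q s - dg t] is small in sup norm, and [E] bounds the operator
   norm of [semigroup G s] for all [s] in [[0, T]]. *)
have SQ : semigroup G s (Q s) x @[s --> A] --> semigroup G t (dg t) x.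
  have S1 : semigroup G s (dg t) x @[s --> A] --> semigroup G t (dg t) x.
    apply: At; apply: differentiable_continuous; apply/derivable1_diffP.
    by have [] := is_derive_semigroup D0 degD t x dgtN.
  have S2 : semigroup G s (fun y => Q s y - dg t y) x @[s --> A] --> (0 : R).
    apply/cvgrPdist_le => e e0.
    have d0 : 0 < e / E by rewrite divr_gt0.
    apply: filterS2 inA (QdgE _ d0) => s; rewrite in_itv/= => /andP[s0 sT] h.
    rewrite sub0r normrN (le_trans (semigroup_bound D0 degD s x h))//.
    rewrite -[leRHS](divfK (lt0r_neq0 E0)) ler_wpM2l ?(ltW d0)//.
    by rewrite ler_expR ler_wpM2r ?mulr_ge0// ger0_norm.
  have := cvgD S2 S1; rewrite add0r => c; refine (near_eq_cvg_to _ (c FF)).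
  apply: filterS QN => s h.
  by rewrite /= (semigroupB D0 degD s x h dgtN) subrK.
have SL := is_derive_quotient `[0, T]%classic
  (is_derive_semigroup D0 degD t x gtM).
refine (near_eq_cvg_to _ (cvgD SQ SL)).
apply: filterS3 inA neqt QN => s s0T st h /=.
have st0 : s - t != 0 by rewrite subr_eq0.
(* With this splitting the increment is that of the semigroup on the fixed function [g t], plus
   [s - t] times the semigroup applied to [Q s]. *)
have gs : g s = (fun y => g t y + (s - t) * Q s y).
  by apply/funext => y; rewrite /Q mulrC divfK// addrC subrK.
have hst y : `|(s - t) * Q s y| <= `|s - t| * (N + 1).
  by rewrite normrM ler_wpM2l.
rewrite gs (semigroupD D0 degD s x gtM hst) (semigroupZ D0 degD (s - t) s x h).
by rewrite mulrDl; field.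
Qed.

End derivative_of_moving_semigroup.

(** * Identities for the operators built from [psi] *)

Section psi_operators.
Context {R : realType} {V : choiceType} (G : wgraph R V) (psi : R -> R).
Implicit Types (u : V -> R) (x : V).

Lemma lap_psiE u x : 0 < u x ->
  lap_psi G psi u x = nbavg G x (fun y => psi (u y / u x) - psi 1).
Proof. by move=> ux; rewrite /lap_psi lapE divff// gt_eqF. Qed.

Lemma OmegaE u x : Omega G psi u x =
  nbavg G x (fun y => derive1 psi (u y / u x) * (u y / u x)
                      * (lap G u y / u y - lap G u x / u x)).
Proof.
by rewrite /Omega lapE; apply: eq_nbavg => y _; rewrite subrr mulr0 subr0.
Qed.

(** The affine part of [psi_bar] yields the Laplacian term, the rest yields [lap_psi]; both are easy
    to follow along the heat flow. *)
Lemma GammaE u x : 0 < u x -> u x * Gamma G psi u x =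
  derive1 psi 1 * lap G u x - u x * lap_psi G psi u x.
Proof.
move=> ux; have ux0 : u x != 0 by rewrite gt_eqF.
rewrite /Gamma /lap_psi !lapE -!nbavgZ -nbavgB; apply: eq_nbavg => y _.
by rewrite /psi_bar divff//; field.
Qed.

(** The second summand on the left is the time derivative of [u * Gamma u] when [u] evolves by
    [u' = - lap u]. The two iterated Laplacians cancel and the definition of [Gamma2] remains. *)
Lemma Gamma2E u x : 0 < u x ->
  lap G (fun y => derive1 psi 1 * lap G u y - u y * lap_psi G psi u y) x +
  (- (derive1 psi 1 * lap G (lap G u) x) + lap G u x * lap_psi G psi u x
   + u x * Omega G psi u x) = 2 * (u x * Gamma2 G psi u x).
Proof.
move=> ux; have ux0 : u x != 0 by rewrite gt_eqF.
have -> : lap G (fun y => derive1 psi 1 * lap G u y - u y * lap_psi G psi u y) x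
    = derive1 psi 1 * lap G (lap G u) x
      - lap G (fun y => u y * lap_psi G psi u y) x.
  rewrite -mulN1r -!lapZ -lapD; congr (lap G _ x).
  by apply/funext => y; rewrite mulN1r.
by rewrite /Gamma2; field.
Qed.

(* The curvature condition is linearized by
   [(lap_psi u)^2 >= 2 c lap_psi u - c^2]. *)
Lemma CDpsi_linearized (n K c : R) u x : 0 < n -> CDpsi G psi n (- K) ->
  (forall y, 0 < u y) ->
  4 * c * derive1 psi 1 / n * lap G u x
    + (- (4 * c / n + 2 * K) * (u x * Gamma G psi u x)
       + - (2 * c ^+ 2 / n) * u x)
  <= 2 * (u x * Gamma2 G psi u x).
Proof.
move=> n0 hCD u0; have ux := u0 x.
apply: (@le_trans _ _ (2 * (u x * (n^-1 * lap_psi G psi u x ^+ 2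
    + - K * Gamma G psi u x)))); last first.
  by rewrite ler_wpM2l// ler_wpM2l ?(ltW ux)// hCD.
have E := GammaE ux.
set P := lap_psi G psi u x in E *.
(* Trading the Laplacian for [Gamma] and [P] makes all terms in [Gamma] cancel and leaves a perfect
   square. *)
have uP : derive1 psi 1 * lap G u x = u x * Gamma G psi u x + u x * P.
  by rewrite E subrK.
rewrite -subr_ge0.
rewrite (_ : _ - _ = 2 * n^-1 * u x * (P - c) ^+ 2); last first.
  rewrite (_ : 4 * c * derive1 psi 1 / n * lap G u x =
    4 * c / n * (derive1 psi 1 * lap G u x)); last by ring.
  by rewrite uP; ring.
apply: mulr_ge0; last exact: sqr_ge0.
by rewrite mulr_ge0 ?(ltW ux)// mulr_ge0// invr_ge0 ltW.
Qed.

End psi_operators.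

(** * Time regularity along a positive solution of the backward heat equation *)

Section backward_heat_flow.
Context {R : realType} {V : choiceType} (G : wgraph R V) (psi : R -> R).
Context {D : R} (D0 : 0 <= D) (degD : forall x, deg G x / vmeas G x <= D).
Context (hpsi : C1_pos psi).
Context {T B C : R} (v : R -> V -> R) (B0 : 0 <= B) (C0 : 0 < C).
Context (v_gt0 : forall s x, s \in `[0, T] -> 0 < v s x).
Context (v_le : forall s x, s \in `[0, T] -> `|v s x| <= B).
Context (v_ratio : forall s x y, s \in `[0, T] -> adj G x y ->
  v s y <= C * v s x).
Context (dv : forall s x, s \in `[0, T] ->
  is_derive s 1 (v^~ x) (- lap G (v s) x)).

Let edges := [set e : V * V | adj G e.1 e.2].
Let ratio (s : R) (e : V * V) := v s e.2 / v s e.1.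
(** By the backward equation, the opposite of the logarithmic time derivative of [v]. *)
Let rate (s : R) (x : V) := lap G (v s) x / v s x.

(** The lower bound is the upper bound for the reversed edge. *)
Lemma ratio_itv s e : s \in `[0, T] -> edges e -> ratio s e \in `[C^-1, C].
Proof.
case: e => x y s0T /= xy; rewrite in_itv/= /ratio/=.
have vx := v_gt0 x s0T; have vy := v_gt0 y s0T.
rewrite ler_pdivrMr// v_ratio// andbT ler_pdivlMr// ler_pdivrMl//.
by rewrite v_ratio// adj_sym.
Qed.

Lemma itv_gt0 (r : R) : r \in `[C^-1, C] -> 0 < r.
Proof.
by rewrite in_itv/= => /andP[+ _]; apply: lt_le_trans; rewrite invr_gt0.
Qed.

Lemma bequicont_v : bequicont 0 T setT v.
Proof.
apply: (@bequicont_lipschitz _ _ _ _ _ _ (fun s x => - lap G (v s) x)).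
- by move=> s x s0T _; exact: dv.
- by exists B => // s x s0T _; exact: v_le.
- exists (2 * D * B); first by rewrite !mulr_ge0.
  by move=> s x s0T _; rewrite normrN; apply: lap_bound => // y; exact: v_le.
Qed.

(** The division by [v s x], which may be arbitrarily small, is absorbed into edge ratios, which
    stay bounded. *)
Lemma rate_ratio s x : s \in `[0, T] ->
  rate s x = nbavg G x (fun y => ratio s (x, y) - 1).
Proof.
move=> s0T; have vx : v s x != 0 by rewrite gt_eqF ?v_gt0.
rewrite /rate lapE mulrC -nbavgZ; apply: eq_nbavg => y _.
by rewrite /ratio/=; field.
Qed.

Lemma rate_bound s x : s \in `[0, T] -> `|rate s x| <= (C + 1) * D.
Proof.
move=> s0T; rewrite rate_ratio//; apply: nbavg_bound => // [|y xy].
  by rewrite addr_ge0// ltW.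
have /[dup] /itv_gt0 r0 := @ratio_itv s (x, y) s0T xy.
rewrite in_itv/= => /andP[_ rC].
by rewrite (le_trans (ler_normB _ _))// normr1 lerD2r ger0_norm// ltW.
Qed.

(** Stated for all pairs of vertices, so as to cover the diagonal pair [(x, x)] met in
    [is_derive_lap_psi]. *)
Lemma is_derive_ratio s e : s \in `[0, T] ->
  is_derive s 1 (ratio^~ e) (- (ratio s e * (rate s e.2 - rate s e.1))).
Proof.
move=> s0T; case: e => x y /=.
have vx : v s x != 0 by rewrite gt_eqF ?v_gt0.
have vy : v s y != 0 by rewrite gt_eqF ?v_gt0.
have dvx := dv x s0T; have dvy := dv y s0T.
have h := is_derive_mul dvy (is_deriveV vx dvx).
apply: (is_derive_eq h); rewrite /ratio /rate.
by rewrite /GRing.scale/=; field; apply/andP.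
Qed.

Lemma bequicont_ratio : bequicont 0 T edges ratio.
Proof.
apply: (@bequicont_lipschitz _ _ _ _ _ _
  (fun s e => - (ratio s e * (rate s e.2 - rate s e.1)))).
- by move=> s e s0T _; exact: is_derive_ratio.
- exists C; first exact: ltW.
  move=> s e s0T /(ratio_itv s0T)/[dup]/itv_gt0 r0.
  by rewrite in_itv/= => /andP[_ rC]; rewrite ger0_norm// ltW.
- exists (C * ((C + 1) * D + (C + 1) * D)).
    by rewrite mulr_ge0 ?addr_ge0 ?mulr_ge0 ?addr_ge0// ltW.
  move=> s e s0T /(ratio_itv s0T)/[dup]/itv_gt0 r0.
  rewrite in_itv/= => /andP[_ rC]; rewrite normrN normrM.
  apply: ler_pM => //; first by rewrite ger0_norm// ltW.
  by rewrite (le_trans (ler_normB _ _))// lerD// rate_bound.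
Qed.

Lemma bequicont_rate : bequicont 0 T setT rate.
Proof.
apply: (@bequicont_eq _ _ _ _ _
  (fun s x => nbavg G x (fun y => ratio s (x, y) - 1))).
  by move=> s x s0T _; rewrite rate_ratio.
apply: (@bequicont_nbavg _ _ _ _ _ D (fun s e => ratio s e - 1)) => //.
by apply: bequicontB; [exact: bequicont_ratio|exact: bequicont_cst].
Qed.

Lemma is_derive_psi (r : R) : 0 < r -> is_derive r 1 psi (derive1 psi r).
Proof.
move=> r0; rewrite derive1E; apply: derivableP.
by apply: hpsi.1; rewrite in_itv/= r0.
Qed.

Lemma bequicont_psi_ratio : bequicont 0 T edges (fun s e => psi (ratio s e)).
Proof.
apply: (@bequicont_postcomp _ _ _ _ _ psi C^-1 C) => //.
- move=> r /itv_gt0 r0; apply: differentiable_continuous.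
  by apply/derivable1_diffP; have [] := is_derive_psi r0.
- by move=> s e; exact: ratio_itv.
- exact: bequicont_ratio.
Qed.

Lemma bequicont_dpsi_ratio :
  bequicont 0 T edges (fun s e => derive1 psi (ratio s e)).
Proof.
apply: (@bequicont_postcomp _ _ _ _ _ (derive1 psi) C^-1 C) => //.
- by move=> r /itv_gt0 r0; apply: hpsi.2; rewrite in_itv/= r0.
- by move=> s e; exact: ratio_itv.
- exact: bequicont_ratio.
Qed.

Lemma bequicont_lap_psi : bequicont 0 T setT (fun s => lap_psi G psi (v s)).
Proof.
apply: (@bequicont_eq _ _ _ _ _
  (fun s x => nbavg G x (fun y => psi (ratio s (x, y)) - psi 1))).
  by move=> s x s0T _; rewrite lap_psiE// v_gt0.
apply: (@bequicont_nbavg _ _ _ _ _ D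
  (fun s e => psi (ratio s e) - psi 1)) => //.
by apply: bequicontB; [exact: bequicont_psi_ratio|exact: bequicont_cst].
Qed.

Lemma bequicont_Omega : bequicont 0 T setT (fun s => Omega G psi (v s)).
Proof.
apply: (@bequicont_eq _ _ _ _ _ (fun s x => nbavg G x (fun y =>
  derive1 psi (ratio s (x, y)) * ratio s (x, y) * (rate s y - rate s x)))).
  by move=> s x s0T _; rewrite OmegaE.
apply: (@bequicont_nbavg _ _ _ _ _ D (fun s e =>
  derive1 psi (ratio s e) * ratio s e * (rate s e.2 - rate s e.1))) => //.
apply: bequicontM.
  by apply: bequicontM; [exact: bequicont_dpsi_ratio|exact: bequicont_ratio].
have h (k : V * V -> V) : bequicont 0 T edges (fun s e => rate s (k e)).
  by apply: (bequicont_comp (J := setT)) => //; exact: bequicont_rate.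
exact: bequicontB (h snd) (h fst).
Qed.

Lemma is_derive_lap_v s x : s \in `[0, T] ->
  is_derive s 1 (fun r => lap G (v r) x) (- lap G (lap G (v s)) x).
Proof.
move=> s0T; rewrite !lapE -nbavgN.
apply: (@is_derive_nbavg _ _ _ _ (fun y r => v r y - v r x)) => y _.
apply: (is_derive_eq (is_deriveB (dv y s0T) (dv x s0T))).
by rewrite opprB opprK addrC.
Qed.

Lemma is_derive_lap_psi s x : s \in `[0, T] ->
  is_derive s 1 (fun r => lap_psi G psi (v r) x) (- Omega G psi (v s) x).
Proof.
move=> s0T; rewrite OmegaE -nbavgN.
apply: (@is_derive_nbavg _ _ _ _
  (fun y r => psi (ratio r (x, y)) - psi (ratio r (x, x)))) => y xy.
(* The Laplacian also subtracts the value at the pair [(x, x)]; its derivative vanishes because the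
   two rates coincide. *)
have dpsi e : edges e \/ e = (x, x) -> is_derive s 1 (fun r => psi (ratio r e))
    (derive1 psi (ratio s e) * - (ratio s e * (rate s e.2 - rate s e.1))).
  move=> he; apply: (@is_derive1_comp _ psi (ratio^~ e)).
    apply: is_derive_psi; case: he => [he|->].
      exact: itv_gt0 (ratio_itv s0T he).
    by rewrite /ratio/= divr_gt0 ?v_gt0.
  exact: is_derive_ratio.
have dxy := dpsi (x, y) (or_introl xy).
have dxx := dpsi (x, x) (or_intror erefl).
apply: (is_derive_eq (is_deriveB dxy dxx)).
by rewrite subrr mulr0 oppr0 mulr0 subr0 mulrN mulrA.
Qed.

(** The right-hand side of [GammaE], equal to [v * Gamma v] for times in [[0, T]]; [dflux] is its
    time derivative. *)
Let flux (s : R) (x : V) :=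
  derive1 psi 1 * lap G (v s) x - v s x * lap_psi G psi (v s) x.
Let dflux (s : R) (x : V) := - (derive1 psi 1 * lap G (lap G (v s)) x)
  + lap G (v s) x * lap_psi G psi (v s) x + v s x * Omega G psi (v s) x.

Lemma bequicont_flux : bequicont 0 T setT flux.
Proof.
apply: bequicontB; last first.
  by apply: bequicontM; [exact: bequicont_v|exact: bequicont_lap_psi].
by apply: bequicontZ; apply: (bequicont_lap D0 degD); exact: bequicont_v.
Qed.

Lemma bequicont_dflux : bequicont 0 T setT dflux.
Proof.
have lapv : bequicont 0 T setT (fun s => lap G (v s)).
  by apply: (bequicont_lap D0 degD); exact: bequicont_v.
apply: bequicontD; last first.
  by apply: bequicontM; [exact: bequicont_v|exact: bequicont_Omega].
apply: bequicontD; last by apply: bequicontM => //; exact: bequicont_lap_psi.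
by apply/bequicontN/bequicontZ; exact: bequicont_lap D0 degD lapv.
Qed.

Lemma is_derive_flux s x : s \in `[0, T] ->
  is_derive s 1 (flux^~ x) (dflux s x).
Proof.
move=> s0T.
have d1 := is_derive_mull (derive1 psi 1) (is_derive_lap_v x s0T).
have d2 := is_derive_mul (dv x s0T) (is_derive_lap_psi x s0T).
apply: (is_derive_eq (is_deriveB d1 d2)).
by rewrite /dflux; ring.
Qed.

Lemma cvg_semigroup_Gamma_quotient t x : t \in `[0, T] ->
  let g s y := v s y * Gamma G psi (v s) y in
  (semigroup G s (g s) x - semigroup G t (g t) x) / (s - t)
    @[s --> within `[0, T] t^'] -->
  semigroup G t (fun y => 2 * (v t y * Gamma2 G psi (v t) y)) x.
Proof.
move=> t0T g.
have gE s : s \in `[0, T] -> g s = flux s.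
  by move=> s0T; apply/funext => y; rewrite /g GammaE ?v_gt0.
have -> : (fun y => 2 * (v t y * Gamma2 G psi (v t) y)) =
    (fun y => lap G (flux t) y + dflux t y).
  by apply/funext => y; rewrite -Gamma2E ?v_gt0.
refine (near_eq_cvg_to _ (@cvg_semigroup_quotient _ _ _ _ D0 degD _ _ _ _ x
  bequicont_flux.1 bequicont_dflux (fun s y => @is_derive_flux s y) t0T)).
have : \forall s \near within `[0, T] t^', s \in `[0, T] by exact: withinT.
by apply: filterS => s s0T; rewrite !gE.
Qed.

Lemma Gamma_bounded : exists N : R, forall t y, t \in `[0, T] ->
  `|v t y * Gamma G psi (v t) y| <= N.
Proof.
have [[N _ h] _] := bequicont_flux; exists N => t y t0T.
by rewrite GammaE ?v_gt0//; exact: h.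
Qed.

(** Read off [lap flux + dflux], which avoids the division by [v] in the definition of [Gamma2]. *)
Lemma Gamma2_bounded : exists N : R, forall t y, t \in `[0, T] ->
  `|2 * (v t y * Gamma2 G psi (v t) y)| <= N.
Proof.
have [[N _ h] _] := bequicont_flux; have [[N' _ h'] _] := bequicont_dflux.
exists (2 * D * N + N') => t y t0T.
rewrite -Gamma2E ?v_gt0// (le_trans (ler_normD _ _))// lerD//; last exact: h'.
by apply: lap_bound => // z; exact: h.
Qed.

End backward_heat_flow.

(** * Real bounds from extended suprema, and relative difference quotients *)

Lemma ereal_sup_ltyP {R : realType} {I : Type} (A : set I) (F : I -> R) :
  (ereal_sup [set (F i)%:E | i in A] < +oo)%E ->
  exists2 M : R, 0 <= M & forall i, A i -> F i <= M.
Proof.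
move=> h; exists (Num.max 0 (fine (ereal_sup [set (F i)%:E | i in A]))).
  by rewrite le_max lexx.
move=> i Ai; have := @ereal_sup_ubound _ [set (F i)%:E | i in A] (F i)%:E.
move=> /(_ (ex_intro2 _ _ _ Ai erefl)); move: h.
by case: ereal_sup => [r _|//|//]; rewrite lee_fin le_max orbC => ->.
Qed.

Lemma ereal_inf_gt0P {R : realType} {I : Type} (A : set I) (F : I -> R) :
  (0 < ereal_inf [set (F i)%:E | i in A])%E ->
  exists2 m : R, 0 < m & forall i, A i -> m <= F i.
Proof.
move=> h.
have lb i : A i -> (ereal_inf [set (F i)%:E | i in A] <= (F i)%:E)%E.
  by move=> Ai; apply: ereal_inf_lbound; exists i.
move: h lb; case: ereal_inf => [r|_ lb|//].
  by rewrite lte_fin => r0 lb; exists r => // i /lb; rewrite lee_fin.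
(* An infinite infimum means that [A] is empty, as for a graph without edges; any positive constant
   will do. *)
by exists 1 => // i /lb.
Qed.

(** Properness makes the relative derivative unique. A nearby point of the segment is found to the
    right of [t], or to the left when [t] is the right endpoint. *)
Lemma within_segment_dnbhs_proper {R : realType} (a b t : R) :
  a < b -> t \in `[a, b] -> ProperFilter (within `[a, b] t^').
Proof.
move=> ab; rewrite in_itv/= => /andP[a_t tb].
apply: Build_ProperFilter_ex => P.
rewrite /within/= => /nbhs_ballP[d /= d0 hd].
have d20 : 0 < d / 2 by rewrite divr_gt0.
have [tltb|bt] := ltP t b.
  pose m := Num.min (d / 2) (b - t).
  have m0 : 0 < m by rewrite lt_min d20 subr_gt0.
  have md : m <= d / 2 by rewrite ge_min lexx.
  have mb : m <= b - t by rewrite ge_min lexx orbT.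
  exists (t + m); apply: hd.
  - by rewrite /ball/= opprD addrA subrr sub0r normrN gtr0_norm//; lra.
  - by rewrite -subr_eq0 addrAC subrr add0r gt_eqF.
  - by rewrite in_itv/=; lra.
pose m := Num.min (d / 2) (b - a).
have m0 : 0 < m by rewrite lt_min d20 subr_gt0.
have md : m <= d / 2 by rewrite ge_min lexx.
have mb : m <= b - a by rewrite ge_min lexx orbT.
exists (t - m); apply: hd.
- by rewrite /ball/= opprB addrCA subrr addr0 gtr0_norm//; lra.
- by rewrite -subr_eq0 addrAC subrr add0r oppr_eq0 gt_eqF.
- by rewrite in_itv/=; lra.
Qed.

Lemma cvg_quotientM {R : realType} (A : set R) (h k : R -> R) (t dh dk : R) :
  (h s - h t) / (s - t) @[s --> within A t^'] --> dh ->
  (k s - k t) / (s - t) @[s --> within A t^'] --> dk ->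
  (h s * k s - h t * k t) / (s - t) @[s --> within A t^'] -->
    dh * k t + h t * dk.
Proof.
move=> hh hk.
have FF : Filter (within A t^') by exact: within_filter.
have neqt : \forall s \near within A t^', s != t.
  by apply: cvg_within; have := nbhs_dnbhs_neq t.
have ct : s - t @[s --> within A t^'] --> (0 : R).
  rewrite -(subrr t); apply: cvgB; last exact: cvg_cst.
  by apply: cvg_within_filter; apply/continuous_withinNx; exact: cvg_id.
(* Convergence of the quotient forces continuity relative to [A], needed for the factor [h s] in the
   product rule. *)
have ch : h s @[s --> within A t^'] --> h t.
  have c : (h s - h t) / (s - t) * (s - t) + h t @[s --> within A t^'] --> h t.
    rewrite -[X in _ --> X]add0r -(mulr0 dh).
    by apply: cvgD; [exact: cvgM|exact: cvg_cst].
  refine (near_eq_cvg_to _ c); apply: filterS neqt => s st.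
  by rewrite /= divfK ?subrK// subr_eq0.
have c : (h s - h t) / (s - t) * k t + h s * ((k s - k t) / (s - t))
    @[s --> within A t^'] --> dh * k t + h t * dk.
  by apply: cvgD; [exact: cvgMr_tmp|exact: cvgM].
refine (near_eq_cvg_to _ c); apply: filterS neqt => s st /=.
have st0 : s - t != 0 by rewrite subr_eq0.
by field.
Qed.
Unset Implicit Arguments.

(** * The differential inequality for [alpha * phi] *)

Theorem theorem3p3 (R : realType) (V : choiceType) (G : wgraph R V)
    (hD : (D_mu G < +oo)%E) (hmu : (mu_max G < +oo)%E) (hw : (0 < w_min G)%E)
    (psi : R -> R) (hpsi : C1_pos psi) (hconc : concave_pos psi)
    (n K : R) (hn : 0 < n) (hK : 0 <= K) (hCD : CDpsi G psi n (- K))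
    (T : R) (hT : 0 < T)
    (f : V -> R) (fbnd : bounded_fun (f : V -> R^o)) (fpos : forall x, 0 < f x)
    (hRf : (ratio_sup G f < +oo)%E)
    (alpha gamma : R -> R)
    (alpha_pos : forall t, t \in `[0, T] -> 0 < alpha t)
    (alpha_C1 : C1_within `[0, T] alpha)
    (gamma_cont : {within `[0, T], continuous gamma}) :
  let v (t : R) : V -> R := semigroup G (T - t) f in
  let phi (t : R) (x : V) : R :=
    semigroup G t (fun y => v t y * Gamma G psi (v t) y) x in
  forall (t : R) (x : V), t \in `[0, T] ->
    derivable_within `[0, T] (fun s => alpha s * phi s x) t /\
    derive_within `[0, T] (fun s => alpha s * phi s x) t >=
      (derive_within `[0, T] alpha t - 4 * alpha t * gamma t / n
         - 2 * alpha t * K) * phi t x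
      + 4 * derive1 psi 1 * alpha t * gamma t / n * lap G (semigroup G T f) x
      - 2 * alpha t * gamma t ^+ 2 / n * semigroup G T f x.
Proof.
move=> v phi t x t0T.
have [D D0 degD] : exists2 D : R, 0 <= D & forall x, deg G x / vmeas G x <= D.
  have [D D0 h] := ereal_sup_ltyP hD; exists D => // y; exact: h.
have [m m0 muM] : exists2 m : R, 0 <= m & forall x, vmeas G x <= m.
  have [m m0 h] := ereal_sup_ltyP hmu; exists m => // y; exact: h.
have [w w0 wmin] := ereal_inf_gt0P hw.
have [r r0 fr0] := ereal_sup_ltyP hRf.
have fr y z : adj G y z -> f z <= r * f y.
  by move=> yz; rewrite -ler_pdivrMr//; exact: (fr0 (y, z)).
have [M fM] : exists M : R, forall y, `|f y| <= M.
  have [M0 [_ h]] := fbnd; exists (M0 + 1) => y.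
  by apply: h => //; rewrite ltrDl.
have M0 : 0 <= M := le_trans (normr_ge0 _) (fM x).
have T0 s : s \in `[0, T] -> 0 <= T - s <= T.
  by rewrite in_itv/= => /andP[s0 sT]; rewrite subr_ge0 sT gerBl.
have v_gt0 s y : s \in `[0, T] -> 0 < v s y.
  by move=> /T0/andP[s0 _]; exact: (semigroup_gt0 D0 degD _ s0 fM).
pose B := M * expR (T * (2 * D)).
have B0 : 0 <= B by rewrite mulr_ge0// expR_ge0.
have v_le s y : s \in `[0, T] -> `|v s y| <= B.
  move=> /T0/andP[s0 sT]; rewrite (le_trans (semigroup_bound D0 degD _ _ fM))//.
  by rewrite ler_wpM2l// ler_expR ler_wpM2r ?mulr_ge0// ger0_norm.
(* The constant of [semigroup_ratio], increased by 1 to be positive even if the first term is 0. *)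
pose C := m * ((r + 1) * D) / w + 1.
have C0' : 0 <= m * ((r + 1) * D) / w.
  by rewrite divr_ge0 ?(ltW w0)// mulr_ge0// mulr_ge0// addr_ge0.
have C0 : 0 < C by rewrite ltr_wpDl.
have v_ratio s y z : s \in `[0, T] -> adj G y z -> v s z <= C * v s y.
  move=> s0T yz; have /andP[s0 _] := T0 s s0T.
  rewrite mulrDl mul1r -[leLHS]addr0 lerD ?(ltW (v_gt0 _ _ s0T))//.
  apply: (semigroup_ratio D0 degD s0 r0 w0 m0 fM _ fr) => //.
  - by move=> ?; exact: ltW.
  - exact: (wmin (y, z)).
have dv s y : s \in `[0, T] -> is_derive s 1 (v^~ y) (- lap G (v s) y).
  move=> _; rewrite (lap_semigroup D0 degD _ _ fM).
  have dTs : is_derive s 1 (fun s => T - s) (- 1 : R).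
    by apply: (is_derive_eq (is_deriveB (is_derive_cst T s 1) (is_derive_id s 1)));
      rewrite sub0r.
  apply: (is_derive_eq (@is_derive1_comp _ (fun s => semigroup G s f y) _ s _ _
    (is_derive_semigroup D0 degD (T - s) y fM) dTs)).
  by rewrite mulrN1.
have cphi := cvg_semigroup_Gamma_quotient D0 degD hpsi B0 C0 v_gt0 v_le v_ratio dv (x := x) t0T.
have := alpha_C1.1 t t0T; rewrite /derivable_within => calpha.
have cprod := cvg_quotientM calpha cphi.
have FP := within_segment_dnbhs_proper hT t0T.
split; first by apply/cvg_ex; eexists; exact: cprod.
rewrite {2}/derive_within (cvg_lim _ cprod)//.
rewrite -[lim _]/(derive_within `[0, T] alpha t).
have /andP[t0 tT] : 0 <= t <= T by rewrite in_itv/= in t0T.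
(* The pointwise bound [CDpsi_linearized] with [c = gamma t], carried through the semigroup by
   monotonicity and linearity. *)
have key : 4 * gamma t * derive1 psi 1 / n * lap G (semigroup G T f) x
   + (- (4 * gamma t / n + 2 * K) * phi t x
      + - (2 * gamma t ^+ 2 / n) * semigroup G T f x) <=
   semigroup G t (fun y => 2 * (v t y * Gamma2 G psi (v t) y)) x.
  (* The semigroup law with [t + (T - t) = T] turns the terms affine in [v] into terms in
     [P_T f]. *)
  have Sv : semigroup G t (v t) = semigroup G T f.
    apply/funext => y; rewrite (semigroup_comp D0 degD _ _ t0 fM).
    by rewrite addrC subrK.
  have [N gN] := Gamma_bounded D0 degD hpsi B0 C0 v_gt0 v_le v_ratio dv.
  have [N2 g2N] := Gamma2_bounded D0 degD hpsi B0 C0 v_gt0 v_le v_ratio dv.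
  have bZ (a L : R) (h : V -> R) : (forall y, `|h y| <= L) ->
      forall y, `|a * h y| <= `|a| * L.
    by move=> hL y; rewrite normrM ler_wpM2l.
  have bD (L L' : R) (h h' : V -> R) : (forall y, `|h y| <= L) ->
      (forall y, `|h' y| <= L') -> forall y, `|h y + h' y| <= L + L'.
    by move=> hL hL' y; rewrite (le_trans (ler_normD _ _))// lerD.
  have vB y : `|v t y| <= B by exact: v_le.
  have lB := fun y => lap_bound degD y vB.
  have gB y := gN t y t0T.
  have b1 := bZ (4 * gamma t * derive1 psi 1 / n) _ _ lB.
  have b2 := bZ (- (4 * gamma t / n + 2 * K)) _ _ gB.
  have b3 := bZ (- (2 * gamma t ^+ 2 / n)) _ _ vB.
  rewrite -Sv (lap_semigroup D0 degD _ _ vB).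
  rewrite -(semigroupZ D0 degD _ _ _ lB) -(semigroupZ D0 degD _ _ _ gB).
  rewrite -(semigroupZ D0 degD _ _ _ vB) -(semigroupD D0 degD _ _ b2 b3).
  rewrite -(semigroupD D0 degD _ _ b1 (bD _ _ _ _ b2 b3)).
  apply: (ler_semigroup D0 degD _ t0 (bD _ _ _ _ b1 (bD _ _ _ _ b2 b3))
    (fun y => g2N t y t0T)) => y.
  by apply: CDpsi_linearized hn hCD _ => z; exact: v_gt0.
have a0 := alpha_pos t t0T.
(* Multiplying by [alpha t > 0] and adding the [alpha'] term of the product rule gives exactly the
   claimed right-hand side. *)
move: key; rewrite -(ler_pM2l a0) => /(lerD (lexx (derive_within `[0, T] alpha t * phi t x))).
apply: le_trans; rewrite le_eqVlt; apply/orP; left; apply/eqP; ring.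
Qed.
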